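(* Let $m\in\mathbb{N}$, let $a_1,\ldots,a_m\ge 0$ be real numbers, and let $f(x)=1+2\sum_{k=1}^m a_k\cos(2k\pi x)$. For $n\in\mathbb{N}$ let $A^{(n)}$ be the $n\times n$ real symmetric matrix with entries $A^{(n)}_{jk}=\int_0^1 f(x)e_{j-1}(x)e_{k-1}(x)\,dx$ for $1\le j,k\le n$, where $e_0=1$ and $e_i(x)=\sqrt2\cos(2i\pi x)$ for $i\ge1$. Assume that there are $m'\le m$ and a positive semidefinite real symmetric $(m'+1)\times(m'+1)$ matrix $B$ such that $f=v^TBv$, where $v^T=\begin{pmatrix}1&\cos(2\pi x)&\cdots&\cos(2m'\pi x)\end{pmatrix}$, and that $\operatorname{tr}(A^{(5)}H)<0$, where $H$ is the Horn matrix. Let $n\ge5$ and let $C=[c_{ij}]_{i,j=1}^n$ be a real symmetric $n\times n$ matrix such that (i) $\operatorname{tr}(A^{(n)}C)<0$; (ii) for some $k\in\mathbb{N}$ the polynomial $\big(\sum_{i=1}^n x_i^2\big)^k\, q_C(x_1,\ldots,x_n)$ is a sum of squares of real polynomials, where $q_C(x_1,\ldots,x_n)=\sum_{i,j=1}^n c_{ij}x_i^2x_j^2$. Then $C$ is an exceptional copositive matrix, i.e. $C$ is copositive but is not the sum of a positive semidefinite matrix and a matrix with nonnegative entries.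
   Context: A real symmetric $n\times n$ matrix $C$ is copositive if $x^TCx\ge0$ for every $x\in\mathbb{R}^n$ with all coordinates nonnegative. In the decomposition, both summands are real symmetric $n\times n$ matrices. The Horn matrix is $$H=\begin{pmatrix}1&-1&1&1&-1\\-1&1&-1&1&1\\1&-1&1&-1&1\\1&1&-1&1&-1\\-1&1&1&-1&1\end{pmatrix}.$$ *)

(* Defs.v *)
From HB Require Import structures.
From mathcomp Require Import all_boot all_order all_algebra.
From mathcomp Require Import all_classical all_reals all_analysis.
(* The notations of multinomials and of mathcomp-analysis cannot be loaded
   together; [mpoly n R] below is the ring of polynomials in n variables. *)
From mathcomp Require Import -(notations) mpoly.

Set Implicit Arguments.
Unset Strict Implicit.
Unset Printing Implicit Defensive.

Import Order.TTheory GRing.Theory Num.Theory.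
Import numFieldNormedType.Exports.

Local Open Scope classical_set_scope.
Local Open Scope ring_scope.

Definition quad_form (R : realType) (n : nat) (C : 'M[R]_n) (x : 'cV[R]_n) : R :=
  (x^T *m C *m x) 0 0.

Definition psd (R : realType) (n : nat) (C : 'M[R]_n) : Prop :=
  C^T = C /\ forall x : 'cV[R]_n, 0 <= quad_form C x.

Definition copositive (R : realType) (n : nat) (C : 'M[R]_n) : Prop :=
  C^T = C /\
  forall x : 'cV[R]_n, (forall i, 0 <= x i 0) -> 0 <= quad_form C x.

Definition sym_nonneg (R : realType) (n : nat) (C : 'M[R]_n) : Prop :=
  C^T = C /\ forall i j, 0 <= C i j.

Definition exceptional_copositive (R : realType) (n : nat) (C : 'M[R]_n) : Prop :=
  copositive C /\
  ~ exists P N : 'M[R]_n, [/\ psd P, sym_nonneg N & C = P + N].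

Definition Horn_rows (R : realType) : seq (seq R) :=
  [:: [::  1; -1;  1;  1; -1];
      [:: -1;  1; -1;  1;  1];
      [::  1; -1;  1; -1;  1];
      [::  1;  1; -1;  1; -1];
      [:: -1;  1;  1; -1;  1]].

Definition Horn (R : realType) : 'M[R]_5 :=
  \matrix_(i < 5, j < 5) nth 0 (nth [::] (Horn_rows R) i) j.

Definition cos_poly (R : realType) (m : nat) (a : nat -> R) (x : R) : R :=
  1 + 2 * \sum_(1 <= k < m.+1) a k * cos (2 * k%:R * pi * x).

Definition cos_basis (R : realType) (i : nat) (x : R) : R :=
  if i == 0%N then 1 else Num.sqrt 2 * cos (2 * i%:R * pi * x).

(* Ordinals start at 0, so the 1-based entry (j, k), which pairs e_{j-1} with
   e_{k-1}, is the entry (j-1, k-1) here. *)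
Definition moment_matrix (R : realType) (f : R -> R) (n : nat) : 'M[R]_n :=
  \matrix_(j < n, k < n)
    \int[lebesgue_measure]_(x in `[0, 1]) (f x * cos_basis j x * cos_basis k x).

Definition cos_vector (R : realType) (m : nat) (x : R) : 'cV[R]_m.+1 :=
  \col_(i < m.+1) cos (2 * i%:R * pi * x).

Definition mvar (R : realType) (n : nat) (i : 'I_n) : mpoly n R :=
  mpolyX R (mnm1 i).

Definition sum_of_squares (R : realType) (n : nat) (p : mpoly n R) : Prop :=
  exists s : seq (mpoly n R), p = \sum_(g <- s) g ^+ 2.

Definition quartic (R : realType) (n : nat) (C : 'M[R]_n) : mpoly n R :=
  \sum_(i < n) \sum_(j < n) C i j *: (mvar R i ^+ 2 * mvar R j ^+ 2).

(* Main.v *)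
(** If C = P + N with P positive semidefinite and N entrywise nonnegative, then
    tr(A C) >= 0, contradicting (i).  Indeed tr(A P) is the integral of f times
    the quadratic form of P at (e_0, ..., e_(n-1)), and f >= 0 by the sum of
    squares representation; while tr(A N) >= 0 because A has nonnegative
    entries: by the product-to-sum formula, f e_j e_k is a nonnegative
    combination of the functions cos(2 k pi x), each of integral 0 or 1.
    Copositivity follows by evaluating (ii) at the square roots of the
    coordinates. *)
Require Import Defs.
From HB Require Import structures.
From mathcomp Require Import all_boot all_order all_algebra.
From mathcomp Require Import all_classical all_reals all_analysis.
From mathcomp Require Import -(notations) mpoly.
From mathcomp Require Import ring.

Set Implicit Arguments.
Unset Strict Implicit.
Unset Printing Implicit Defensive.

Import Order.TTheory GRing.Theory Num.Theory.
Import numFieldNormedType.Exports.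

Local Open Scope classical_set_scope.
Local Open Scope ring_scope.

(** * The convex cone generated by the cosines *)

(** An inductive predicate rather than explicit finite sums: closure under products, continuity and
    the sign of the integral then all follow by induction on how a function is built. *)
Inductive cos_cone (R : realType) : (R -> R) -> Prop :=
| cos_cone_cos k : cos_cone (fun x => cos (2 * k%:R * pi * x))
| cos_cone0 : cos_cone (fun=> 0)
| cos_coneD g h : cos_cone g -> cos_cone h -> cos_cone (fun x => g x + h x)
| cos_coneZ c g : 0 <= c -> cos_cone g -> cos_cone (fun x => c * g x).

Lemma cos_cone1 (R : realType) : cos_cone (fun=> 1 : R).
Proof.
have := @cos_cone_cos R 0; congr cos_cone; apply/funext => x.
by rewrite mulr0 !mul0r cos0.
Qed.

Lemma cos_cone_sum (R : realType) (r : seq nat) (Q : pred nat)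
    (F : nat -> R -> R) :
  (forall i, Q i -> cos_cone (F i)) ->
  cos_cone (fun x => \sum_(i <- r | Q i) F i x).
Proof.
move=> FQ; elim: r => [|i r IHr].
  by under eq_fun do rewrite big_nil; exact: cos_cone0.
under eq_fun do rewrite big_cons.
by case: (boolP (Q i)) => [/FQ Fi|_]; [exact: cos_coneD | exact: IHr].
Qed.

(** By bilinearity, induction on both factors reduces the claim to two generators, where the
    product-to-sum formula has the nonnegative coefficient 1/2. *)
Lemma cos_coneM (R : realType) (g h : R -> R) :
  cos_cone g -> cos_cone h -> cos_cone (fun x => g x * h x).
Proof.
move=> gC hC; elim: gC => {g}.
- move=> k; elim: hC => {h}.
  (* The frequency [k - l] is a truncated subtraction, so the larger index must come first. *)
  + move=> l; wlog lek : k l / (l <= k)%N.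
      move=> W; case: (leqP l k) => [|/ltnW] /W //.
      by congr cos_cone; apply/funext => x; rewrite mulrC.
    have -> : (fun x : R => cos (2 * k%:R * pi * x) * cos (2 * l%:R * pi * x)) =
        fun x => 2^-1 * (cos (2 * (k + l)%:R * pi * x)
                         + cos (2 * (k - l)%:R * pi * x)).
      apply/funext => x; rewrite natrD natrB//.
      have -> : 2 * (k%:R + l%:R) * pi * x = 2 * k%:R * pi * x + 2 * l%:R * pi * x :> R.
        by ring.
      have -> : 2 * (k%:R - l%:R) * pi * x = 2 * k%:R * pi * x - 2 * l%:R * pi * x :> R.
        by ring.
      by rewrite cosD cosB; field.
    by apply: cos_coneZ; [rewrite invr_ge0|apply: cos_coneD; exact: cos_cone_cos].
  + by under eq_fun do rewrite mulr0; exact: cos_cone0.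
  + by move=> g h _ IHg _ IHh; under eq_fun do rewrite mulrDr; exact: cos_coneD.
  + by move=> c g c0 _ IHg; under eq_fun do rewrite mulrCA; exact: cos_coneZ.
- by under eq_fun do rewrite mul0r; exact: cos_cone0.
- by move=> g h' _ IHg _ IHh; under eq_fun do rewrite mulrDl; exact: cos_coneD.
- by move=> c g c0 _ IHg; under eq_fun do rewrite -mulrA; exact: cos_coneZ.
Qed.

(** * Integrals over the unit interval *)

Lemma is_derive_linear_arg (R : realType) (c x : R) :
  is_derive x 1 (fun y : R => c * y) c.
Proof.
have := is_deriveZ c (is_derive_id x (1 : R)).
by rewrite /GRing.scale /= mulr1.
Qed.

Lemma continuous_cos_scale (R : realType) (c : R) :
  continuous (fun x : R => cos (c * x)).
Proof.
move=> x; apply: (@continuous_comp _ _ _ (fun y : R => c * y) cos).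
  exact: mulrl_continuous.
exact: continuous_cos.
Qed.

Lemma continuous_sin_scale (R : realType) (c : R) :
  continuous (fun x : R => sin (c * x)).
Proof.
move=> x; apply: (@continuous_comp _ _ _ (fun y : R => c * y) sin).
  exact: mulrl_continuous.
exact: continuous_sin.
Qed.

Lemma cos_cone_continuous (R : realType) (g : R -> R) :
  cos_cone g -> continuous g.
Proof.
elim=> {g} [k|||].
- exact: continuous_cos_scale.
- by move=> x; exact: cvg_cst.
- by move=> g h _ cg _ ch x; apply: cvgD; [exact: cg|exact: ch].
- by move=> c g _ _ cg x; apply: cvgM; [exact: cvg_cst|exact: cg].
Qed.

Lemma continuous_integrable01 (R : realType) (g : R -> R) : continuous g ->
  (@lebesgue_measure R).-integrable `[0, 1] (EFin \o g).
Proof.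
move=> cg; apply: continuous_compact_integrable; first exact: segment_compact.
exact: continuous_subspaceT.
Qed.

Lemma sin_2pinat (R : realType) (k : nat) : sin (2 * k%:R * pi) = 0 :> R.
Proof.
elim: k => [|k IHk]; first by rewrite mulr0 mul0r sin0.
have -> : 2 * k.+1%:R * pi = 2 * k%:R * pi + pi *+ 2 :> R by ring.
by rewrite sinD2pi.
Qed.

(** For [k = 0] the integrand is 1. Otherwise the frequency [c] is nonzero, and the antiderivative
    [c^-1 * sin (c * x)] vanishes at both endpoints because [c] is a multiple of $2\pi$. *)
Lemma Rintegral_cos_ge0 (R : realType) (k : nat) :
  0 <= \int[@lebesgue_measure R]_(x in `[0, 1]) cos (2 * k%:R * pi * x).
Proof.
case: k => [|k].
  by apply: Rintegral_ge0 => x _; rewrite mulr0 !mul0r cos0.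
set c : R := 2 * k.+1%:R * pi.
have c0 : c != 0 by rewrite lt0r_neq0// !mulr_gt0// pi_gt0.
have dF (x : R) : is_derive x 1 (fun y : R => c^-1 * sin (c * y)) (cos (c * x)).
  have ds := is_derive1_comp (is_derive_sin (c * x)) (is_derive_linear_arg c x).
  have := is_deriveZ c^-1 ds.
  by rewrite /GRing.scale /= mulrCA mulVf ?mulr1.
have cF : continuous (fun y : R => c^-1 * sin (c * y)).
  move=> x; apply: cvgM; [exact: cvg_cst|exact: continuous_sin_scale].
rewrite /Rintegral (@continuous_FTC2 _ _ (fun y => c^-1 * sin (c * y)))//.
- by rewrite -EFinB/= mulr1 mulr0 sin0 sin_2pinat mulr0 subrr.
- exact/continuous_subspaceT/continuous_cos_scale.
- split.
  + by move=> x _; exact: ex_derive.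
  + exact/cvg_at_right_filter/cF.
  + exact/cvg_at_left_filter/cF.
- by move=> x _; rewrite derive1E; exact: derive_val.
Qed.

Lemma cos_cone_Rintegral_ge0 (R : realType) (g : R -> R) : cos_cone g ->
  0 <= \int[lebesgue_measure]_(x in `[0, 1]) g x.
Proof.
elim=> {g} [k||g h gC IHg hC IHh|c g c0 gC IHg].
- exact: Rintegral_cos_ge0.
- exact: Rintegral_ge0.
- rewrite RintegralD ?addr_ge0//.
    exact/continuous_integrable01/cos_cone_continuous.
  exact/continuous_integrable01/cos_cone_continuous.
- rewrite RintegralZl ?mulr_ge0//.
  exact/continuous_integrable01/cos_cone_continuous.
Qed.

Lemma cos_cone_cos_basis (R : realType) (i : nat) : cos_cone (@cos_basis R i).
Proof.
rewrite /cos_basis; case: eqP => _; first exact: cos_cone1.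
by apply: cos_coneZ; [exact: sqrtr_ge0|exact: cos_cone_cos].
Qed.

Lemma cos_cone_cos_poly (R : realType) (m : nat) (a : nat -> R) :
  (forall k : nat, (1 <= k <= m)%N -> 0 <= a k) -> cos_cone (cos_poly m a).
Proof.
move=> a0; apply: cos_coneD; first exact: cos_cone1.
apply: cos_coneZ => //.
(* This puts the bounds on [k] into the predicate of the sum, since the sign of [a k] is known only
   within them. *)
under eq_fun do rewrite big_nat.
by apply: cos_cone_sum => k /a0 ak0; apply: cos_coneZ => //; exact: cos_cone_cos.
Qed.

Lemma moment_matrix_ge0 (R : realType) (f : R -> R) (n : nat) (i j : 'I_n) :
  cos_cone f -> 0 <= moment_matrix f n i j.
Proof.
move=> fC; rewrite mxE; apply: cos_cone_Rintegral_ge0.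
by do 2![apply: cos_coneM; last exact: cos_cone_cos_basis].
Qed.

(** * Traces against the moment matrix *)

(** Both claims share one induction: additivity of the integral requires the tail of the sum to be
    integrable, which comes from its continuity. *)
Lemma Rintegral01_sum (R : realType) (I : Type) (r : seq I) (F : I -> R -> R) :
  (forall i, continuous (F i)) ->
  continuous (fun x => \sum_(i <- r) F i x) /\
  \int[lebesgue_measure]_(x in `[0, 1]) (\sum_(i <- r) F i x) =
    \sum_(i <- r) \int[lebesgue_measure]_(x in `[0, 1]) F i x.
Proof.
move=> cF; elim: r => [|i r [cr IHr]].
  under eq_fun do rewrite big_nil; split; first by move=> x; exact: cvg_cst.
  by rewrite big_nil /Rintegral integral0.
under eq_fun do rewrite big_cons; split.
  by move=> x; apply: cvgD; [exact: cF|exact: cr].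
by rewrite big_cons RintegralD ?IHr//; exact: continuous_integrable01.
Qed.

Lemma quad_formE (R : realType) (n : nat) (C : 'M[R]_n) (x : 'cV[R]_n) :
  quad_form C x = \sum_i \sum_j C i j * x i 0 * x j 0.
Proof.
rewrite /quad_form mxE exchange_big; apply: eq_bigr => j _.
rewrite mxE mulr_suml; apply: eq_bigr => i _.
by rewrite mxE (mulrC (x i 0)).
Qed.

Lemma tr_moment_matrix_mul (R : realType) (f : R -> R) (n : nat) (C : 'M[R]_n) :
  continuous f -> C^T = C ->
  \tr (moment_matrix f n *m C) =
  \int[lebesgue_measure]_(x in `[0, 1])
    (f x * quad_form C (\col_(i < n) cos_basis i x)).
Proof.
move=> cf symC.
have cfe (i j : 'I_n) :
    continuous (fun x => f x * cos_basis i x * cos_basis j x).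
  move=> x; apply: cvgM; [apply: cvgM|]; first exact: cf.
    exact/cos_cone_continuous/cos_cone_cos_basis.
  exact/cos_cone_continuous/cos_cone_cos_basis.
have cfeZ (i j : 'I_n) :
    continuous (fun x => C i j * (f x * cos_basis i x * cos_basis j x)).
  by move=> x; apply: cvgM; [exact: cvg_cst|exact: cfe].
transitivity (\int[lebesgue_measure]_(x in `[0, 1])
    \sum_(i < n) \sum_(j < n) C i j * (f x * cos_basis i x * cos_basis j x)); last first.
  apply: eq_Rintegral => x _; rewrite quad_formE mulr_sumr.
  apply: eq_bigr => i _; rewrite mulr_sumr; apply: eq_bigr => j _.
  by rewrite !mxE; ring.
(* The outer sum leaves the integral first; its summands, the inner sums, are continuous by the
   first component of the same lemma. *)
rewrite (Rintegral01_sum _ _).2; last by move=> i; exact: (Rintegral01_sum _ _).1.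
apply: eq_bigr => i _; rewrite mxE (Rintegral01_sum _ _).2//.
apply: eq_bigr => j _; rewrite RintegralZl//; last exact: continuous_integrable01.
(* The trace pairs the entry (i, j) of the moment matrix with [C j i], the quadratic form with
   [C i j]. *)
by rewrite mxE mulrC -{1}symC mxE.
Qed.

Lemma tr_moment_matrix_psd_ge0 (R : realType) (f : R -> R) (n : nat)
    (P : 'M[R]_n) :
  continuous f -> (forall x, 0 <= f x) -> psd P ->
  0 <= \tr (moment_matrix f n *m P).
Proof.
move=> cf f0 [symP P0]; rewrite tr_moment_matrix_mul//.
by apply: Rintegral_ge0 => x _; rewrite mulr_ge0.
Qed.

Lemma tr_mul_ge0 (R : realType) (n : nat) (A N : 'M[R]_n) :
  (forall i j, 0 <= A i j) -> (forall i j, 0 <= N i j) -> 0 <= \tr (A *m N).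
Proof.
move=> A0 N0; apply: sumr_ge0 => i _; rewrite mxE.
by apply: sumr_ge0 => j _; exact: mulr_ge0.
Qed.

(** * Evaluation of polynomials and copositivity *)

Lemma meval_mvar (R : realType) (n : nat) (v : 'I_n -> R) (i : 'I_n) :
  meval v (mvar R i) = v i.
Proof. exact: mevalXU. Qed.

Lemma meval_sum_of_squares_ge0 (R : realType) (n : nat) (p : mpoly n R)
    (v : 'I_n -> R) : sum_of_squares p -> 0 <= meval v p.
Proof.
case=> s ->; rewrite rmorph_sum; apply: sumr_ge0 => g _.
by rewrite rmorphXn; exact: sqr_ge0.
Qed.

Lemma meval_quartic (R : realType) (n : nat) (C : 'M[R]_n) (v : 'I_n -> R) :
  meval v (quartic C) = quad_form C (\col_i (v i ^+ 2)).
Proof.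
rewrite quad_formE rmorph_sum; apply: eq_bigr => i _.
rewrite rmorph_sum; apply: eq_bigr => j _.
by rewrite [LHS]mevalZ mevalM !rmorphXn /= !meval_mvar !mxE mulrA.
Qed.

(** At the square roots of the coordinates of [x], the sum of squares becomes $(\sum_i x_i)^k\,
    x^TCx$, and the first factor can be cancelled once it is positive. *)
Lemma copositive_quartic_sos (R : realType) (n : nat) (C : 'M[R]_n) (k : nat) :
  C^T = C ->
  sum_of_squares ((\sum_(i < n) mvar R i ^+ 2) ^+ k * quartic C) ->
  copositive C.
Proof.
move=> symC sos; split=> // x x0.
have := meval_sum_of_squares_ge0 (fun i => Num.sqrt (x i 0)) sos.
rewrite mevalM rmorphXn rmorph_sum /= meval_quartic.
under eq_bigr do rewrite rmorphXn /= meval_mvar sqr_sqrtr//.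
have -> : \col_i (Num.sqrt (x i 0) ^+ 2) = x.
  by apply/colP => i; rewrite mxE sqr_sqrtr.
(* At the origin the factor may vanish, but there the quadratic form is 0. *)
have [->|xN0] := eqVneq x 0.
  by move=> _; rewrite /quad_form mulmx0 mxE.
rewrite pmulr_rge0// exprn_gt0// lt0r sumr_ge0// andbT psumr_neq0//.
(* By contraposition: a nonnegative vector without a positive coordinate is zero. *)
apply: contraNT xN0 => /hasPn xneg; apply/eqP/colP => i; apply/eqP.
by have := xneg i (mem_index_enum i); rewrite mxE /= lt0r x0 andbT negbK.
Qed.

Theorem mainTheorem2 (R : realType) (m : nat) (a : nat -> R)
  (a_ge0 : forall k : nat, (1 <= k <= m)%N -> 0 <= a k)
  (f_sos : exists m' : nat, (m' <= m)%N /\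
     exists B : 'M[R]_m'.+1, psd B /\
       forall x : R, cos_poly m a x = quad_form B (cos_vector m' x))
  (trA5H : \tr (moment_matrix (cos_poly m a) 5 *m Horn R) < 0)
  (n : nat) (n_ge5 : (5 <= n)%N) (C : 'M[R]_n) (C_sym : C^T = C)
  (trAC : \tr (moment_matrix (cos_poly m a) n *m C) < 0)
  (qC_sos : exists k : nat,
     sum_of_squares ((\sum_(i < n) mvar R i ^+ 2) ^+ k * quartic C)) :
  exceptional_copositive C.
Proof.
have [k /copositive_quartic_sos cop] := qC_sos; split; first exact: cop.
case=> P [N [psdP [_ N0] CE]].
have fC := cos_cone_cos_poly a_ge0.
have f0 x : 0 <= cos_poly m a x.
  by have [m' [_ [B [[_ B0] ->]]]] := f_sos.
(* The trace splits along [P + N]; the first term uses the pointwise sign [f0], the second the cone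
   membership [fC]. *)
move: trAC; rewrite CE mulmxDr mxtraceD ltNge addr_ge0//.
  by apply: tr_moment_matrix_psd_ge0 => //; exact: cos_cone_continuous.
by apply: tr_mul_ge0 => // i j; exact: moment_matrix_ge0.
Qed.
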